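(* Let $N\ge 1$ be an integer and let $\lambda$ be a complex number. Then the generating function of the hypergeometric degenerate Cauchy numbers $\gamma_{N,n}(\lambda)$ has the continued fraction expansion $$\sum_{n=0}^\infty\gamma_{N,n}(\lambda)\frac{x^n}{n!}=1-\cfrac{(\lambda-N)x}{N+1+(\lambda-N)x-\cfrac{(N+1)(\lambda-N-1)x}{N+2+(\lambda-N-1)x-\cfrac{(N+2)(\lambda-N-2)x}{N+3+(\lambda-N-2)x-\ddots}}}\,,$$ i.e. the continued fraction $a_0+\cfrac{b_1}{a_1+\cfrac{b_2}{a_2+\ddots}}$ with $a_0=1$, $b_1=-(\lambda-N)x$, $a_n=N+n+(\lambda-N-n+1)x$ for $n\ge 1$, and $b_n=-(N+n-1)(\lambda-N-n+1)x$ for $n\ge 2$.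
   Context: The hypergeometric degenerate Cauchy numbers $\gamma_{N,n}(\lambda)$ are defined by $$\frac{1}{{}_2F_1(1,N-\lambda;N+1;-x)}=\sum_{n=0}^\infty\gamma_{N,n}(\lambda)\frac{x^n}{n!},$$ where ${}_2F_1(a,b;c;z)=\sum_{n=0}^\infty\frac{(a)^{(n)}(b)^{(n)}}{(c)^{(n)}}\frac{z^n}{n!}$ and $(y)^{(n)}=y(y+1)\cdots(y+n-1)$ for $n\ge 1$, $(y)^{(0)}=1$. Convention on continued fractions: for polynomials $a_n$ ($n\ge 0$), $b_n$ ($n\ge 1$) in $x$, the convergents $P_n/Q_n$ of $a_0+\cfrac{b_1}{a_1+\cfrac{b_2}{a_2+\ddots}}$ are defined by $P_{-1}=1$, $Q_{-1}=0$, $P_0=a_0$, $Q_0=1$, $P_n=a_nP_{n-1}+b_nP_{n-2}$, $Q_n=a_nQ_{n-1}+b_nQ_{n-2}$ ($n\ge 1$). A formal power series $f(x)$ has this continued fraction expansion (written as an equality) if for every $n\ge 0$ the power series expansion at $x=0$ of $P_n(x)/Q_n(x)$ agrees with $f(x)$ up to and including the term in $x^n$, i.e. $P_n/Q_n\equiv f\pmod{x^{n+1}}$; in particular $f=\lim_{n\to\infty}P_n/Q_n$ as formal power series. *)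

(* Defs.v *)
From HB Require Import structures.
From mathcomp Require Import all_boot all_order all_algebra.
From mathcomp Require Import reals complex.

Set Implicit Arguments.
Unset Strict Implicit.
Unset Printing Implicit Defensive.

Import GRing.Theory.
Local Open Scope ring_scope.

(* A formal power series is its coefficient sequence f : nat -> F, standing
   for \sum_n f n x^n; equality of series is pointwise, f =1 g. *)
Section PowerSeries.
Variable F : fieldType.
Implicit Types (f g : nat -> F) (p q : {poly F}).

Definition fps_one : nat -> F := fun n => (n == 0%N)%:R.

Definition fps_mul f g : nat -> F :=
  fun n => \sum_(i < n.+1) f i * g (n - i)%N.

(* f(c x) *)
Definition fps_dilate (c : F) f : nat -> F := fun n => c ^+ n * f n.

Definition fps_of_poly p : nat -> F := fun n => p`_n.

(* Coefficients n, n-1, ..., 0 of 1/f, in this order. *)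
Fixpoint fps_inv_rev f (n : nat) : seq F :=
  if n is m.+1 then
    let s := fps_inv_rev f m in
    (- (f 0%N)^-1 * \sum_(i < m.+1) f i.+1 * s`_i) :: s
  else [:: (f 0%N)^-1].

(* The reciprocal 1/f, meaningful when f 0 != 0; see fps_mulfV. *)
Definition fps_inv f : nat -> F := fun n => head 0 (fps_inv_rev f n).

Lemma nth_fps_inv_rev f m i :
  (i <= m)%N -> (fps_inv_rev f m)`_i = fps_inv f (m - i).
Proof.
elim: m i => [|m IHm] [|i] //= le_im.
by rewrite subSS; exact: IHm.
Qed.

Lemma fps_mulfV f : f 0%N != 0 -> fps_mul f (fps_inv f) =1 fps_one.
Proof.
move=> f0 [|n]; rewrite /fps_mul /fps_one.
  by rewrite big_ord1 /fps_inv /= mulfV.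
rewrite big_ord_recl subn0 {1}/fps_inv /= mulrA mulrN mulfV // mulN1r.
rewrite addrC; apply/eqP; rewrite subr_eq0; apply/eqP.
apply: eq_bigr => i _; rewrite nth_fps_inv_rev ?subSS //.
by rewrite -ltnS.
Qed.

(* g is the expansion at 0 of the rational function p / q. *)
Definition ratfun_expansion p q g : Prop :=
  q != 0 /\ fps_mul (fps_of_poly q) g =1 fps_of_poly p.

(* f = g mod x^n *)
Definition fps_eqmod (n : nat) f g : Prop :=
  forall i : nat, (i < n)%N -> f i = g i.

End PowerSeries.

Section ContinuedFraction.
Variable F : fieldType.
Implicit Types a b : nat -> {poly F}.

(* Convergents of a 0 + b 1 / (a 1 + b 2 / (a 2 + ...)); the inner match gives
   the term of index n - 2, with the value at index -1 in its first branch.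
   The value b 0 is never used. *)
Fixpoint cf_num a b (n : nat) : {poly F} :=
  match n with
  | 0 => a 0%N
  | m.+1 => a n * cf_num a b m
            + b n * match m with 0 => 1 | k.+1 => cf_num a b k end
  end.

Fixpoint cf_den a b (n : nat) : {poly F} :=
  match n with
  | 0 => 1
  | m.+1 => a n * cf_den a b m
            + b n * match m with 0 => 0 | k.+1 => cf_den a b k end
  end.

Definition has_cf_expansion (f : nat -> F) a b : Prop :=
  forall n : nat, exists g : nat -> F,
    ratfun_expansion (cf_num a b n) (cf_den a b n) g /\ fps_eqmod n.+1 g f.

End ContinuedFraction.

Section HypergeometricDegenerateCauchy.
Variable F : fieldType.

Definition rising_factorial (y : F) (n : nat) : F :=
  \prod_(i < n) (y + i%:R).

(* 2F1(a, b; c; z) as a power series in z *)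
Definition hyper2F1 (a b c : F) : nat -> F := fun n =>
  rising_factorial a n * rising_factorial b n / rising_factorial c n
  / (n`!)%:R.

Definition hdc_number (N : nat) (lambda : F) (n : nat) : F :=
  (n`!)%:R *
  fps_inv (fps_dilate (-1) (hyper2F1 1 (N%:R - lambda) (N.+1)%:R)) n.

Definition hdc_genfun (N : nat) (lambda : F) : nat -> F :=
  fun n => hdc_number N lambda n / (n`!)%:R.

Definition hdc_cf_a (N : nat) (lambda : F) (n : nat) : {poly F} :=
  if n is 0 then 1
  else (N + n)%:R%:P + (lambda - N%:R - n%:R + 1) *: 'X.

(* The value at 0 is a dummy. *)
Definition hdc_cf_b (N : nat) (lambda : F) (n : nat) : {poly F} :=
  match n with
  | 0 => 0
  | 1 => - (lambda - N%:R) *: 'X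
  | _ => - ((N + n - 1)%:R * (lambda - N%:R - n%:R + 1)) *: 'X
  end.

End HypergeometricDegenerateCauchy.

(* The defining identity of the numbers. *)
Lemma hdc_genfunP (F : numFieldType) (N : nat) (lambda : F) :
  fps_mul (fps_dilate (-1) (hyper2F1 1 (N%:R - lambda) (N.+1)%:R))
          (hdc_genfun N lambda) =1 fps_one F.
Proof.
set h := fps_dilate _ _ => n.
have h0 : h 0%N != 0.
  rewrite /h /fps_dilate /hyper2F1 /rising_factorial !big_ord0.
  by rewrite expr0 fact0 !divr1 !mulr1 oner_eq0.
rewrite -(fps_mulfV h0); apply: eq_bigr => i _; congr (_ * _).
rewrite /hdc_genfun /hdc_number mulrAC mulfV ?mul1r //.
by rewrite Num.Theory.pnatr_eq0 -lt0n fact_gt0.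
Qed.

(* Main.v *)
(* This is Euler's continued fraction: with h(x) = 2F1(1, N - lambda; N + 1; -x),
   clearing denominators makes the n-th convergent have numerator the constant
   (N+1)(N+2)...(N+n) and denominator that constant times the truncation of h
   at degree n.  The convergent is thus the reciprocal of the truncation, and
   the first n + 1 coefficients of 1/h depend only on those of h. *)
Require Import Defs.
From mathcomp Require Import all_boot all_order all_algebra.
From mathcomp Require Import reals complex.
From mathcomp Require Import ring.

Local Open Scope ring_scope.
Local Open Scope complex_scope.

Import GRing.Theory Num.Theory.

Section PowerSeriesReciprocal.
Context {F : fieldType}.
Implicit Types f g : nat -> F.

(** The whole lists are compared because each new coefficient of a reciprocal is computed from all
    the earlier ones. *)
Lemma eq_fps_inv_rev f g n :
  fps_eqmod n.+1 f g -> fps_inv_rev f n = fps_inv_rev g n.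
Proof.
elim: n => [|n IHn] eq_fg /=; first by rewrite eq_fg.
rewrite IHn => [|i lt_in]; last by apply: eq_fg; rewrite ltnW.
rewrite eq_fg //; congr (_ * _ :: _); apply: eq_bigr => i _.
by rewrite eq_fg // ltnS.
Qed.

Lemma fps_eqmod_inv f g n :
  fps_eqmod n f g -> fps_eqmod n (fps_inv f) (fps_inv g).
Proof.
move=> eq_fg i lt_in; rewrite /fps_inv (@eq_fps_inv_rev f g) // => j lt_ji.
by apply: eq_fg; apply: leq_trans lt_in.
Qed.

Lemma ratfun_expansion_inv (c : F) (p : {poly F}) :
  c != 0 -> p`_0 != 0 ->
  ratfun_expansion c%:P (c *: p) (fps_inv (fps_of_poly p)).
Proof.
move=> c0 p0; split=> [|n].
  by rewrite scaler_eq0 negb_or c0; apply: contraNneq p0 => ->; rewrite coef0.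
transitivity (c * fps_mul (fps_of_poly p) (fps_inv (fps_of_poly p)) n).
  by rewrite mulr_sumr; apply: eq_bigr => i _; rewrite /fps_of_poly coefZ mulrA.
rewrite fps_mulfV // /fps_of_poly /fps_one coefC.
by case: eqP; rewrite ?mulr1 ?mulr0.
Qed.

End PowerSeriesReciprocal.

Lemma rising_factorialS {F : fieldType} (y : F) n :
  rising_factorial y n.+1 = rising_factorial y n * (y + n%:R).
Proof. by rewrite /rising_factorial big_ord_recr. Qed.

(** Kept free of division so that it holds in every characteristic. *)
Lemma rising_factorial_nat {F : fieldType} (m n : nat) :
  rising_factorial m.+1%:R n * m`!%:R = (m + n)`!%:R :> F.
Proof.
elim: n => [|n IHn]; first by rewrite /rising_factorial big_ord0 mul1r addn0.
by rewrite rising_factorialS mulrAC IHn addnS factS mulnC natrM -natrD addSn.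
Qed.

Lemma rising_factorial_nat_neq0 {F : numFieldType} (m n : nat) :
  rising_factorial m.+1%:R n != 0 :> F.
Proof.
have: (m + n)`!%:R != 0 :> F by rewrite pnatr_eq0 -lt0n fact_gt0.
by rewrite -rising_factorial_nat mulf_eq0 negb_or => /andP[].
Qed.

Section Convergents.
Context {F : fieldType} (N : nat) (lambda : F).
Let a := hdc_cf_a N lambda.
Let b := hdc_cf_b N lambda.
Let C n : F := rising_factorial N.+1%:R n.
(** This is $(\lambda-N)(\lambda-N-1)\cdots(\lambda-N-n+1)$. *)
Let D n : F := (-1) ^+ n * rising_factorial (N%:R - lambda) n.

(** Once $P_{n-1}=(N+n-1)P_{n-2}$, the $x$-part of $a_nP_{n-1}$ cancels $b_nP_{n-2}$. The recurrence
    has two terms, so two consecutive values are carried through the induction. *)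
Lemma hdc_cf_numE n : cf_num a b n = (C n)%:P.
Proof.
suff: cf_num a b n = (C n)%:P /\ cf_num a b n.+1 = (C n.+1)%:P by case.
elim: n => [|n [IHn IHn1]].
  rewrite /C /rising_factorial big_ord0 big_ord1 /= -!mul_polyC.
  by split=> //; rewrite addn1 !rmorphD !rmorphN /=; ring.
split=> //; rewrite [LHS]/= -/(cf_num a b n.+1) IHn1 IHn.
have CS k : C k.+1 = C k * (N + k.+1)%:R.
  by rewrite /C rising_factorialS -natrD addSnnS.
by rewrite !CS !addnS subn1 [_.-1]/= -!mul_polyC; ring.
Qed.

(** The recurrence regroups as $Q_{n+1}-(N+n+1)Q_n=(\lambda-N-n)x\,(Q_n-(N+n)Q_{n-1})$, so these
    differences form a product, which is [D n.+1] times $x^{n+1}$. *)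
Lemma hdc_cf_den_rec n :
  cf_den a b n.+1 = (N + n.+1)%:R%:P * cf_den a b n + D n.+1 *: 'X^(n.+1).
Proof.
elim: n => [|n IHn].
  rewrite /D /rising_factorial big_ord1 expr1 /= addr0 -!mul_polyC.
  ring.
rewrite [LHS]/= -/(cf_den a b n.+1).
set Q := cf_den a b n in IHn *; rewrite IHn.
have -> : D n.+2 = (lambda - N%:R - n.+1%:R) * D n.+1.
  by rewrite /D [rising_factorial _ n.+2]rising_factorialS exprS; ring.
rewrite !addnS subn1 [_.-1]/= -!mul_polyC !exprS.
by move: (D _) 'X^n => d Y; ring.
Qed.

End Convergents.

(** Dividing [hdc_cf_den_rec] by $(N+1)\cdots(N+n+1)$ makes it telescope: each step adds one
    monomial, the next term of the series. *)
Lemma hdc_cf_denE {F : numFieldType} (N : nat) (lambda : F) n :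
  cf_den (hdc_cf_a N lambda) (hdc_cf_b N lambda) n =
  rising_factorial N.+1%:R n *:
    \poly_(i < n.+1)
      fps_dilate (-1) (hyper2F1 1 (N%:R - lambda) N.+1%:R) i.
Proof.
elim: n => [|n IHn].
  rewrite poly_def big_ord1 /fps_dilate /hyper2F1 /rising_factorial !big_ord0.
  by rewrite !expr0 fact0 !divr1 !mulr1 !scale1r.
rewrite hdc_cf_den_rec IHn [in RHS]poly_def big_ord_recr -poly_def /=.
rewrite scalerDr !mul_polyC !scalerA; congr (_ *: _ + _ *: _).
  by rewrite rising_factorialS mulrC addnS -addSn natrD.
have fact_neq0 k : k`!%:R != 0 :> F by rewrite pnatr_eq0 -lt0n fact_gt0.
have C_neq0 := rising_factorial_nat_neq0 (F := F) N n.+1.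
(* The upper parameter 1 contributes a factorial that cancels the one in the denominator of
   [hyper2F1]. *)
have rf1 : rising_factorial 1 n.+1 = n.+1`!%:R :> F.
  by rewrite -[LHS]mulr1; exact: (rising_factorial_nat 0 n.+1).
rewrite /fps_dilate /hyper2F1 rf1; field.
by rewrite fact_neq0 C_neq0.
Qed.

Lemma hdc_genfunE {F : numFieldType} (N : nat) (lambda : F) :
  hdc_genfun N lambda =1
  fps_inv (fps_dilate (-1) (hyper2F1 1 (N%:R - lambda) N.+1%:R)).
Proof.
move=> n; rewrite /hdc_genfun /hdc_number mulrAC mulfV ?mul1r //.
by rewrite pnatr_eq0 -lt0n fact_gt0.
Qed.

Theorem theorem2 (R : realType) (N : nat) (hN : (1 <= N)%N) (lambda : R[i]) :
  has_cf_expansion (hdc_genfun N lambda) (hdc_cf_a N lambda) (hdc_cf_b N lambda).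
Proof.
move=> n; rewrite hdc_cf_numE hdc_cf_denE.
set h := fps_dilate _ _.
exists (fps_inv (fps_of_poly (\poly_(i < n.+1) h i))); split.
  apply: ratfun_expansion_inv; first exact: rising_factorial_nat_neq0.
  (* The constant term of the truncation is 1. *)
  rewrite coef_poly /= /h /fps_dilate /hyper2F1 /rising_factorial !big_ord0.
  by rewrite expr0 fact0 !divr1 !mulr1 oner_eq0.
move=> i lt_in; rewrite hdc_genfunE; apply: fps_eqmod_inv lt_in => j lt_jn.
by rewrite /fps_of_poly coef_poly lt_jn.
Qed.
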